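(* Let $k\in\mathbb{N}$ and let $\vec v=(v_n(x))_{n=0}^\infty\in V^\infty(A)$ be a sequence of variable words. Let $r\geq 2$ and suppose that $\langle\vec v\parallel (A_{k+n})_{n=0}^\infty\rangle_c=\bigcup_{i=1}^r E_i$. Then there exist $1\leq i\leq r$ and an infinite extracted $k$-block subsequence $\vec u=(u_n(x))_{n=0}^\infty$ of $\vec v$ such that $\langle\vec u\parallel (A_{k+n})_{n=0}^\infty\rangle_c\subseteq E_i$.
   Context: $\mathbb{N}=\{0,1,2,\dots\}$. Fix an increasing sequence $A_0\subseteq A_1\subseteq A_2\subseteq\cdots$ of nonempty finite sets (alphabets) and let $A=\bigcup_{n\in\mathbb{N}}A_n$. $W(A)$ is the set of all finite words over $A$, including the empty word; words are concatenated by juxtaposition. Fix a symbol $x\notin A$. A variable word is a finite word over $A\cup\{x\}$ in which $x$ occurs at least once; $V(A)$ is the set of variable words, $V^\infty(A)$ the set of infinite sequences of variable words. For $s(x)\in V(A)$ and $a\in A\cup\{x\}$, $s(a)$ is obtained by replacing every occurrence of $x$ by $a$. For a finite sequence $(s_n(x))_{n=p}^q$ of variable words and nonempty sets $B_p,\dots,B_q\subseteq A$, the extracted constant span $\langle(s_n(x))_{n=p}^q\parallel(B_n)_{n=p}^q\rangle_c$ is the set of all words $s_{l_0}(a_0)s_{l_1}(a_1)\cdots s_{l_j}(a_j)$ with $j\geq 0$, $p\leq l_0<l_1<\dots<l_j\leq q$ and $a_i\in B_{l_i}$ for all $0\le i\le j$; the extracted variable span is $\langle(s_n(x))_{n=p}^q\parallel(B_n)_{n=p}^q\rangle_v=V(A)\cap\langle(s_n(x))_{n=p}^q\parallel(B_n\cup\{x\})_{n=p}^q\rangle_c$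 (here letters from $B_{l_i}\cup\{x\}$ are substituted). For an infinite sequence $\vec s=(s_n(x))_{n=0}^\infty$ and sets $(B_n)_{n=0}^\infty$, $\langle\vec s\parallel(B_n)_{n=0}^\infty\rangle_c=\bigcup_{m}\langle(s_n(x))_{n=0}^m\parallel(B_n)_{n=0}^m\rangle_c$. For $k\in\mathbb{N}$ and $\vec s\in V^\infty(A)$, a finite sequence $(t_n(x))_{n=0}^l$ is an extracted $k$-block subsequence of $\vec s$ if there are integers $0=m_0<\dots<m_{l+1}$ with $t_i(x)\in\langle(s_n(x))_{n=m_i}^{m_{i+1}-1}\parallel(A_{k+n})_{n=m_i}^{m_{i+1}-1}\rangle_v$ for all $0\leq i\leq l$; an infinite sequence is an extracted $k$-block subsequence of $\vec s$ if each of its finite initial segments is. *)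

(* Defs.v *)
From mathcomp Require Import all_boot.
From mathcomp Require Import mathcomp_extra boolp classical_sets functions cardinality.

Set Implicit Arguments.
Unset Strict Implicit.
Unset Printing Implicit Defensive.

Local Open Scope classical_set_scope.

(* All letters, including the variable [x], live in one type [T]; words over
   A together with [x] are elements of [seq T]. *)
Section Words.
Context {T : choiceType}.
Implicit Types (x : T) (A B : nat -> set T) (s t : nat -> seq T) (w : seq T).

Definition alphabet A : set T := \bigcup_n A n.

Definition variable_words A x : set (seq T) :=
  [set w | x \in w /\ forall c : T, c \in w -> (alphabet A `|` [set x]) c].

Definition subst x w (a : T) : seq T := [seq if c == x then a else c | c <- w].

(* [la] lists the pairs (l_0, a_0), ..., (l_j, a_j); being nonempty encodes
   j >= 0. *)
Definition const_span x s B (p q : nat) : set (seq T) :=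
  [set w | exists la : seq (nat * T),
    [/\ la <> [::],
        sorted ltn (unzip1 la),
        forall l a, (l, a) \in la -> p <= l <= q /\ B l a
      & w = flatten [seq subst x (s la_i.1) la_i.2 | la_i <- la]]].

Definition var_span A x s B (p q : nat) : set (seq T) :=
  variable_words A x `&` const_span x s (fun n => B n `|` [set x]) p q.

Definition inf_const_span x s B : set (seq T) :=
  \bigcup_m const_span x s B 0 m.

(* The finite sequence is (t_0, ..., t_l): only the values of [t] and of the
   bounds [m] up to indices l and l.+1 are constrained. *)
Definition finite_block_subseq A x (k : nat) s (l : nat) t : Prop :=
  exists m : nat -> nat,
    [/\ m 0 = 0,
        forall i, i <= l -> m i < m i.+1
      & forall i, i <= l ->
          var_span A x s (fun n => A (k + n)) (m i) (m i.+1).-1 (t i)].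

Definition block_subseq A x (k : nat) s t : Prop :=
  forall l, finite_block_subseq A x k s l t.

End Words.

(* Main.v *)
(* Choosing finitely many pairs (l, a) as in [const_span] gives a located word;
   these words live in the free monoid on [nat * T], whose ultrafilters form a
   compact right topological semigroup.  Let D (resp. V) be the ultrafilters
   concentrating on located constant (resp. variable) words arbitrarily far to
   the right.  There are an idempotent p in D and a q in V such that every
   substitution x := a maps q to p; this uses that p is minimal in D, as in the
   ultrafilter proof of the Hales-Jewett theorem.  Some colour class belongs to
   p, and the sequence u is then built as in the Galvin-Glazer proof of
   Hindman's theorem, choosing each term from a member of q. *)

Require Import Defs.
From mathcomp Require Import all_boot.
From mathcomp Require Import mathcomp_extra boolp classical_sets functions cardinality.
From mathcomp Require Import filter topology.

Local Open Scope classical_set_scope.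

(** * Minimal closed sets in compact spaces *)

Lemma compact_bigcap_chain (K : topologicalType) (C : set (set K)) :
    compact [set: K] -> C !=set0 -> total_on C subset ->
    (forall B, C B -> closed B /\ B !=set0) ->
  \bigcap_(B in C) B !=set0.
Proof.
move=> cK C0 Ctot Cok.
have PF : ProperFilter (filter_from C id).
  apply: filter_from_proper => [|B /Cok[]//].
  apply: filter_from_filter => // B1 B2 C1 C2.
  have [sB|sB] := Ctot _ _ C1 C2.
  - by exists B1 => // z B1z; split=> //; exact: sB.
  - by exists B2 => // z B2z; split=> //; exact: sB.
have [|z [_ clz]] := cK (filter_from C id) PF; first exact: filterT.
exists z => B CB; apply: (Cok B CB).1.
by move: clz; rewrite clusterE; apply; exists B.
Qed.

(** The property [Q] is left abstract because it serves twice below, for subsemigroups and for left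
    ideals. *)
Lemma exists_minimal_closed (K : topologicalType) (Q : set (set K)) (M0 : set K) :
    compact [set: K] ->
    (forall C : set (set K), C `<=` Q -> C !=set0 -> Q (\bigcap_(B in C) B)) ->
    closed M0 -> M0 !=set0 -> Q M0 ->
  exists M, [/\ M `<=` M0, closed M, M !=set0, Q M &
    forall N, N `<=` M -> closed N -> N !=set0 -> Q N -> N = M].
Proof.
move=> cK Qcap M0cl M0n0 QM0.
(* [Zorn_bigcup] gives maximal elements for unions, so it is applied to the part [Y] removed from
   [M0]; a maximal [Y] leaves a minimal remainder. *)
pose P := [set Y | [/\ closed (M0 `\` Y), M0 `\` Y !=set0 & Q (M0 `\` Y)]].
have [|A [[Acl An0 QA] Amax]] := @Zorn_bigcup K P.
  move=> F FP Ftot; have [->|/set0P F0] := eqVneq F set0.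
    by rewrite /P /= bigcup_set0 setD0.
  pose C := [set M0 `\` Y | Y in F].
  have -> : P (\bigcup_(X in F) X) =
      [/\ closed (\bigcap_(B in C) B), \bigcap_(B in C) B !=set0
        & Q (\bigcap_(B in C) B)].
    suff -> : \bigcap_(B in C) B = M0 `\` \bigcup_(X in F) X by [].
    apply/seteqP; split=> z.
      move=> Cz; have [Y FY] := F0; split.
        by have [] : (M0 `\` Y) z by apply: Cz; exists Y.
      move=> [X FX Xz].
      by have [_ []] : (M0 `\` X) z by apply: Cz; exists X.
    by move=> [Mz nFz] _ [Y FY <-]; split=> // Yz; apply: nFz; exists Y.
  have C0 : C !=set0 by have [Y FY] := F0; exists (M0 `\` Y); exists Y.
  split.
  - by apply: (@closed_bigI _ _ C id) => _ [Y /FP[? _ _] <-].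
  - apply: compact_bigcap_chain => //; last by move=> _ [Y /FP[? ? _] <-].
    move=> _ _ [X FX <-] [Y FY <-].
    by have [XY|XY] := Ftot _ _ FX FY; [right|left]; apply: setDS.
  - by apply: Qcap => // _ [Y /FP[_ _ ?] <-].
exists (M0 `\` A); split=> //.
move=> N NM Ncl Nn0 QN; apply: contrapT => NneM.
have MN : M0 `\` (A `|` (M0 `\` N)) = N.
  apply/seteqP; split=> z /=.
    by move=> [Mz /not_orP[_ nMN]]; apply: contrapT => nNz; apply: nMN.
  by move=> Nz; have [Mz nAz] := NM _ Nz; split=> // -[//|[_]]; apply.
apply: (Amax (A `|` (M0 `\` N))); last by rewrite /P /= MN.
split; first exact: subsetUl.
move=> sub; apply: NneM; apply/seteqP; split=> // z [Mz nAz].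
by apply: contrapT => nNz; apply/nAz/sub; right.
Qed.

(** * Compact right topological semigroups *)

Section RightTopologicalSemigroup.
Context {K : topologicalType} {op : K -> K -> K}.
Hypothesis cK : compact [set: K].
Hypothesis hK : hausdorff_space K.
Hypothesis opA : associative op.
Hypothesis op_cont : forall q, continuous (op^~ q).

Lemma closed_opr (M : set K) (q : K) : closed M -> closed [set op m q | m in M].
Proof.
move=> Mcl; apply: compact_closed => //.
apply: continuous_compact; first exact/continuous_subspaceT/op_cont.
exact: subclosed_compact Mcl cK _.
Qed.

(** The Ellis-Numakura lemma. In a minimal closed subsemigroup [L] any [m] works: [L m] is a closed
    subsemigroup, hence equals [L]; so the [z] in [L] with [op z m = m] form a nonempty closed
    subsemigroup, hence all of [L], including [m]. *)
Lemma exists_idempotent (M : set K) : closed M -> M !=set0 ->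
  (forall a b, M a -> M b -> M (op a b)) -> exists2 p, M p & op p p = p.
Proof.
move=> Mcl Mn0 Mop.
pose Q := [set N : set K | forall a b, N a -> N b -> N (op a b)].
have [|L [LM Lcl [m Lm] QL Lmin]] :=
  @exists_minimal_closed K Q M cK _ Mcl Mn0 Mop.
  by move=> C CQ _ a b Ca Cb N CN; apply: CQ => //; [exact: Ca|exact: Cb].
have LmE : [set op z m | z in L] = L.
  apply: Lmin.
  - by move=> _ [z Lz <-]; exact: QL.
  - exact: closed_opr.
  - by exists (op m m); exists m.
  - move=> _ _ [a La <-] [b Lb <-].
    by exists (op (op a m) b); rewrite ?opA //; apply: (QL _ b) => //; exact: QL.
have stabE : L `&` [set z | op z m = m] = L.
  apply: Lmin.
  - exact: subIsetl.
  - apply: closedI => //.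
    have /accessible_closed_set1 cl1 := hausdorff_accessible hK.
    by have /continuous_closedP/(_ _ (cl1 m)) := op_cont m.
  - by have [z Lz zm] : [set op z m | z in L] m by [rewrite LmE]; exists z.
  - move=> a b [La /= ea] [Lb /= eb]; split; first exact: QL.
    by rewrite /= -opA eb.
exists m; first exact: LM.
by have [] : (L `&` [set z | op z m = m]) m by rewrite stabE.
Qed.

(* Take [p] idempotent in a minimal left ideal of [D] and an idempotent [e] of
   the left ideal [V p]; then [q := p e] is an idempotent below [p], so [h q]
   is an idempotent of [D] below the minimal idempotent [h p = p]. *)
Lemma exists_common_retract (D V : set K) (H : set (K -> K)) :
    closed D -> D !=set0 -> (forall a b, D a -> D b -> D (op a b)) ->
    closed V -> V !=set0 -> (forall a b, V a -> V b -> V (op a b)) ->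
    (forall a b, D a -> V b -> V (op a b)) ->
    (forall a b, V a -> D b -> V (op a b)) ->
    (forall h, H h -> [/\ {morph h : a b / op a b}, forall d, D d -> h d = d
                        & forall z, V z -> D (h z)]) ->
  exists p q, [/\ D p, op p p = p, V q & forall h, H h -> h q = p].
Proof.
move=> Dcl Dn0 DD Vcl Vn0 VV DV VD Hh.
(* Among subsets of [D], these are the left ideals of [D]. *)
pose Q := [set N : set K | forall d z, D d -> N z -> N (op d z)].
have [|L [LD Lcl Ln0 QL Lmin]] := @exists_minimal_closed K Q D cK _ Dcl Dn0 DD.
  by move=> C CQ _ d z Dd Cz N CN; apply: (CQ N CN) => //; exact: Cz.
have [p Lp pp] : exists2 p, L p & op p p = p.
  by apply: exists_idempotent => // a b La Lb; apply: QL => //; exact: LD.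
have Dp := LD _ Lp.
have [|||_ [y Vy <-] ee] := @exists_idempotent [set op y p | y in V].
- exact: closed_opr.
- by have [y Vy] := Vn0; exists (op y p); exists y.
- move=> _ _ [a Va <-] [b Vb <-].
  by exists (op (op a p) b); rewrite ?opA //; apply: VV => //; exact: VD.
exists p, (op p (op y p)); split=> //; first by apply: DV => //; exact: VD.
move=> h /Hh[hM hD hV].
set g := h _.
have gE : g = op p (op (h y) p) by rewrite /g !hM !(hD p).
have gg : op g g = g.
  rewrite /g -hM; congr h.
  by rewrite -!opA (opA p p) pp (opA y p) ee.
(* By minimality [D g = L], so [p = op d g] for some [d]. Then [op p g = p] because [g] is
   idempotent, while [op p g = g] because [g] begins with [p]. *)
have Lg : L g by rewrite gE; apply: (QL) => //; apply: QL => //; exact: hV.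
have DgE : [set op d g | d in D] = L.
  apply: Lmin.
  - by move=> _ [d Dd <-]; exact: QL.
  - exact: closed_opr.
  - by exists (op g g); exists g => //; exact: LD.
  - by move=> d _ Dd [d' Dd' <-]; exists (op d d'); rewrite ?opA //; exact: DD.
have [d Dd dg] : [set op d g | d in D] p by rewrite DgE.
have pg : op p g = g by rewrite gE opA pp.
by rewrite -pg -[in LHS]dg -opA gg.
Qed.

End RightTopologicalSemigroup.

Lemma continuous_into_prod (X : topologicalType) (I : eqType)
    (T : I -> topologicalType) (f : X -> prod_topology T) :
  (forall i, continuous (fun x => f x i)) -> continuous f.
Proof.
by move=> cf x; apply/cvg_sup => i; apply: continuous_comp_initial (cf i) x.
Qed.

(** * The semigroup of ultrafilters *)

Section Ultrafilters.
Context {S : Type} {mul : S -> S -> S}.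
Hypothesis mulA : associative mul.

(* Quantifiers on [S] with the topology of pointwise convergence; ultrafilters
   are those that are Boolean homomorphisms. *)
Local Notation K := (prod_topology (fun _ : set S => bool)).

Definition ultra (p : K) : Prop :=
  (forall B C, p (B `&` C) = p B && p C) /\ (forall B, p (~` B) = ~~ p B).

Definition ultra_on (W : nat -> set S) : set K :=
  [set p | ultra p /\ forall n, p (W n)].

(** The usual product of ultrafilters extending [mul], with the order of quantifiers that makes it
    continuous in the left argument. *)
Definition conv (p q : K) : K :=
  fun B => p [set w | q [set w' | B (mul w w')]].

Definition push (f : S -> S) (p : K) : K := fun B => p (f @^-1` B).

Lemma ultraS (p : K) (B C : set S) : ultra p -> B `<=` C -> p B -> p C.
Proof. by move=> [pI _] /setIidPl <-; rewrite pI => /andP[]. Qed.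

Lemma ultra0 (p : K) : ultra p -> p set0 = false.
Proof. by move=> [pI pC]; rewrite -(setICr set0) pI pC andbN. Qed.

Lemma ultraT (p : K) : ultra p -> p setT.
Proof. by move=> pU; rewrite -setC0 pU.2 ultra0. Qed.

Lemma ultra_eq (p : K) (W B C : set S) : ultra p -> p W ->
  (forall w, W w -> B w <-> C w) -> p B = p C.
Proof.
move=> pU pW BC; apply/idP/idP => pB.
  apply: (@ultraS p (W `&` B)) => //; last by rewrite pU.1 pW.
  by move=> w [Ww /(BC _ Ww)].
apply: (@ultraS p (W `&` C)) => //; last by rewrite pU.1 pW.
by move=> w [Ww /(BC _ Ww)].
Qed.

Lemma ultra_finite_bigcap (p : K) (I : choiceType) (D : set I) (F : I -> set S) :
  ultra p -> finite_set D -> (forall i, D i -> p (F i)) ->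
  p (\bigcap_(i in D) F i).
Proof.
move=> pU /finite_seqP[s ->] pF; rewrite bigcap_seq.
elim: s pF => [|i s IH] pF; first by rewrite big_nil; exact: ultraT.
rewrite big_cons pU.1 pF ?IH//= ?mem_head// => j js.
by apply: pF; rewrite /= inE js orbT.
Qed.

Lemma ultra_ord_bigcup (p : K) r (F : 'I_r -> set S) :
  ultra p -> p (\bigcup_i F i) -> exists i, p (F i).
Proof.
move=> pU pF; apply: contrapT => npF.
suff : p (\bigcap_i ~` F i) by rewrite -setC_bigcup pU.2 pF.
apply: ultra_finite_bigcap => [//||i _]; first exact: finite_finset; rewrite pU.2.
by apply/negP => pFi; apply: npF; exists i.
Qed.

Lemma compact_ultraspace : compact [set: K].
Proof.
have -> : [set: K] = [set f | forall B : set S, [set: bool] (f B)].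
  by apply/seteqP; split.
exact: (@tychonoff (set S) (fun=> bool) (fun=> setT) (fun=> bool_compact)).
Qed.

Lemma hausdorff_ultraspace : hausdorff_space K.
Proof. by apply: hausdorff_product => _; exact: discrete_hausdorff. Qed.

Lemma nbhs_eval (p : K) (B : set S) : nbhs p [set p' : K | p' B = p B].
Proof.
have /(_ p [set b | b = p B]) := @proj_continuous (set S) (fun=> bool) B.
by apply; exact: discrete_set1.
Qed.

(** A condition on finitely many discrete coordinates is locally constant. Three coordinates suffice
    for each clause of [ultra_on]. *)
Lemma closed_eval (P : bool -> bool -> bool -> Prop) (B C D : set S) :
  closed [set p : K | P (p B) (p C) (p D)].
Proof.
move=> p.
move=> /(_ _ (filterI (nbhs_eval p B) (filterI (nbhs_eval p C) (nbhs_eval p D)))).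
by move=> [p' [/= PB [<- [<- <-]]]].
Qed.

Lemma closed_ultra_on (W : nat -> set S) : closed (ultra_on W).
Proof.
have -> : ultra_on W =
    (\bigcap_(BC in [set: set S * set S])
       [set p : K | p (BC.1 `&` BC.2) = p BC.1 && p BC.2]) `&`
    (\bigcap_(B in [set: set S]) [set p : K | p (~` B) = ~~ p B]) `&`
    (\bigcap_(n in [set: nat]) [set p : K | p (W n)]).
  apply/seteqP; split=> p.
    move=> [[pI pC] pW]; split; last by move=> n _; exact: pW.
    by split=> [[B C] _|B _]; [exact: pI|exact: pC].
  move=> [[pI pC] pW]; split; last by move=> n; exact: pW.
  by split=> [B C|B]; [exact: (pI (B, C))|exact: pC].
apply: closedI; [apply: closedI|]; apply: closed_bigI => i _.
- exact: (@closed_eval (fun a b c => a = b && c)).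
- exact: (@closed_eval (fun a b _ => a = ~~ b) _ _ set0).
- exact: (@closed_eval (fun a _ _ => a) _ set0 set0).
Qed.

Lemma ultra_on_neq0 (W : nat -> set S) :
  (forall m n, m <= n -> W n `<=` W m) -> (forall n, W n !=set0) ->
  ultra_on W !=set0.
Proof.
move=> Wdecr Wn0.
have PF : ProperFilter (filter_from [set: nat] W).
  apply: filter_from_proper => [|n _ //].
  apply: filter_from_filter; first by exists 0.
  move=> m n _ _; exists (maxn m n) => // w Ww.
  by split; apply: Wdecr Ww; rewrite ?leq_maxl ?leq_maxr.
have [G [GU WG]] := ultraFilterLemma PF.
exists (fun B => `[< G B >]); split; last first.
  by move=> n; apply/asboolP/WG; exists n.
split=> [B C|B].
  rewrite -asbool_and; apply/asbool_equiv_eq.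
  split; last by case=> ? ?; exact: filterI.
  by move=> GBC; split; apply: filterS GBC; [exact: subIsetl|exact: subIsetr].
rewrite -asbool_neg; apply/asbool_equiv_eq; split.
  by move=> GnB GB; have [w []] := filter_ex (filterI GB GnB).
by move=> nGB; have [] := in_ultra_setVsetC B GU.
Qed.

Lemma convA : associative conv.
Proof.
move=> p q t; apply/funext => B; rewrite /conv.
congr (p _); apply/funext => w /=.
congr (is_true (q _)); apply/funext => w' /=.
congr (is_true (t _)); apply/funext => w'' /=.
by rewrite mulA.
Qed.

(** The coordinate of [conv p q] at [B] is the coordinate of [p] at a set depending only on [q] and
    [B]. *)
Lemma conv_continuous (q : K) : continuous (conv^~ q).
Proof.
apply: continuous_into_prod => B.
exact: (@proj_continuous (set S) (fun=> bool)
  [set w | q [set w' | B (mul w w')]]).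
Qed.

Lemma ultra_conv (p q : K) : ultra p -> ultra q -> ultra (conv p q).
Proof.
move=> [pI pC] [qI qC]; split=> [B C|B]; rewrite /conv -?pI -?pC; congr (p _).
  apply/funext => w; apply/propext.
  have qBC := qI [set w' | B (mul w w')] [set w' | C (mul w w')].
  split=> [qw|[qB qC']]; first by apply/andP; rewrite -qBC.
  by apply: (eq_ind_r is_true _ qBC); apply/andP.
apply/funext => w; apply/propext.
have qB := qC [set w' | B (mul w w')].
split=> [qw|/negP qw]; first by apply/negP; rewrite -qB.
exact: (eq_ind_r is_true qw qB).
Qed.

(** The index [m] may depend on [w]: a located word can be appended only beyond the last index of
    [w]. *)
Lemma ultra_on_conv (W1 W2 W3 : nat -> set S) (p q : K) :
    (forall n w, W1 n w -> exists m, forall w', W2 m w' -> W3 n (mul w w')) ->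
  ultra_on W1 p -> ultra_on W2 q -> ultra_on W3 (conv p q).
Proof.
move=> W123 [pU pW] [qU qW]; split; first exact: ultra_conv.
move=> n; apply: ultraS (pW n) => // w /W123[m Wm] /=.
exact: ultraS (qW m).
Qed.

Lemma ultra_on_push (W1 W2 : nat -> set S) (f : S -> S) (p : K) :
    (forall n, exists m, forall w, W1 m w -> W2 n (f w)) ->
  ultra_on W1 p -> ultra_on W2 (push f p).
Proof.
move=> W12 [[pI pC] pW]; split.
  by split=> [B C|B]; [exact: pI|exact: pC].
move=> n; have [m Wm] := W12 n.
exact: (ultraS _ _ _ (conj pI pC) Wm (pW m)).
Qed.

Lemma push_conv (f : S -> S) (p q : K) : {morph f : a b / mul a b} ->
  push f (conv p q) = conv (push f p) (push f q).
Proof.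
move=> fM; apply/funext => B; rewrite /push /conv.
congr (p _); apply/funext => w /=.
by congr (is_true (q _)); apply/funext => w' /=; rewrite fM.
Qed.

(** This reduces the hypotheses of [exists_common_retract] to conditions on [S]. Fixing [W 0]
    pointwise is enough for [h], since [W 0] belongs to every ultrafilter in [ultra_on W]. *)
Lemma exists_ultra_retract (W V : nat -> set S) (H : set (S -> S)) :
    (forall m n, m <= n -> W n `<=` W m) -> (forall n, W n !=set0) ->
    (forall m n, m <= n -> V n `<=` V m) -> (forall n, V n !=set0) ->
    (forall n w, W n w -> exists m, forall w', W m w' -> W n (mul w w')) ->
    (forall n w, W n w -> exists m, forall w', V m w' -> V n (mul w w')) ->
    (forall n w, V n w -> exists m, forall w', W m w' -> V n (mul w w')) ->
    (forall n w, V n w -> exists m, forall w', V m w' -> V n (mul w w')) ->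
    (forall h, H h -> [/\ {morph h : a b / mul a b}, forall w, W 0 w -> h w = w
                        & forall n, exists m, forall w, V m w -> W n (h w)]) ->
  exists p q, [/\ ultra_on W p, conv p p = p, ultra_on V q
                & forall h, H h -> push h q = p].
Proof.
move=> Wd W0 Vd V0 WW WV VW VV Hh.
have [|p [q [Wp pp Vq hq]]] := @exists_common_retract K conv compact_ultraspace
  hausdorff_ultraspace convA conv_continuous (ultra_on W) (ultra_on V)
  [set push h | h in H] (@closed_ultra_on _) (ultra_on_neq0 _ Wd W0)
  (fun _ _ => ultra_on_conv _ _ _ _ _ WW) (@closed_ultra_on _)
  (ultra_on_neq0 _ Vd V0) (fun _ _ => ultra_on_conv _ _ _ _ _ VV)
  (fun _ _ => ultra_on_conv _ _ _ _ _ WV)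
  (fun _ _ => ultra_on_conv _ _ _ _ _ VW) _.
  move=> _ [h /Hh[hM hW hV] <-]; split.
  - by move=> a b; exact: push_conv.
  - move=> p [pU pW]; apply/funext => B.
    by apply: (ultra_eq _ _ _ _ pU (pW 0)) => w /hW /=  ->.
  - by move=> z; exact: ultra_on_push.
by exists p, q; split=> // h Hh'; apply: hq; exists h.
Qed.

End Ultrafilters.

(** * The Galvin-Glazer construction *)

Section Galvin.
Context {S : Type} {T : choiceType} {mul : S -> S -> S}.
Local Notation K := (prod_topology (fun _ : set S => bool)).

(* Since [p = p p], almost every [w] in [G] satisfies [w^-1 G \in p]; as
   [h_a q = p] for the finitely many letters [a] of [B n], one [s] from [V]
   can be chosen whose images [h_a s] are all such [w]. *)
Lemma exists_extension (h : T -> S -> S) (B : set T) (p q : K) (V : nat -> set S)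
    (G : set S) m :
    finite_set B -> ultra p -> @conv _ mul p p = p -> ultra_on V q ->
    (forall a, B a -> push (h a) q = p) -> p G ->
  exists2 s, V m s &
    forall a, B a -> G (h a s) /\ p [set w | G (mul (h a s) w)].
Proof.
move=> Bfin pU pp [qU qV] hq pG.
pose G' := G `&` [set w | p [set w' | G (mul w w')]].
have pG' : p G'.
  rewrite pU.1 pG /=.
  by have : @conv _ mul p p G by rewrite pp.
have qVG : q (V m `&` \bigcap_(a in B) (h a @^-1` G')).
  rewrite qU.1 qV /=; apply: ultra_finite_bigcap => [//|//|a Ba].
  by have : push (h a) q G' by rewrite hq.
have [s [Vs Gs]] : (V m `&` \bigcap_(a in B) (h a @^-1` G')) !=set0.
  have [E0|/set0P//] := eqVneq (V m `&` \bigcap_(a in B) (h a @^-1` G')) set0.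
  by rewrite E0 ultra0 in qVG.
by exists s.
Qed.

(** The extension step is iterated while [G] shrinks to the words that may follow every image of the
    chosen term; finiteness of [B n] keeps [G] in [p]. The bound [bnd] pushes each term beyond the
    previous one. *)
Lemma exists_span_sequence (h : T -> S -> S) (B : nat -> set T) (p q : K)
    (V : nat -> set S) (bnd : S -> nat) (E : set S) :
    (forall n, finite_set (B n)) -> ultra p -> @conv _ mul p p = p ->
    ultra_on V q -> (forall n a, B n a -> push (h a) q = p) -> p E ->
  exists (t : nat -> S) (G : nat -> set S),
    [/\ G 0 = E, V 0 (t 0), forall n, V (bnd (t n)) (t n.+1),
        forall n, G n.+1 `<=` G n
      & forall n a, B n a -> G n (h a (t n)) /\
          forall w, G n.+1 w -> G n (mul (h a (t n)) w)].
Proof.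
move=> Bfin pU pp qV hq pE.
pose good n m (G : set S) s := V m s /\
  forall a, B n a -> G (h a s) /\ p [set w | G (mul (h a s) w)].
have goodP n m G : p G -> exists s, good n m G s.
  move=> pG; have [s Vs Gs] := exists_extension h (B n) p q V G m
    (Bfin n) pU pp qV (hq n) pG.
  by exists s.
have [s0 _] := goodP 0 0 E pE.
(* [choice] needs a total selector; [s0] is a dummy value for sets outside [p]. *)
have /choice[f fP] : forall nmG : nat * nat * set S, exists s,
    p nmG.2 -> good nmG.1.1 nmG.1.2 nmG.2 s.
  move=> [[n m] G] /=; have [pG|_] := boolP (p G); last by exists s0.
  by have [s Gs] := goodP n m G pG; exists s.
(* The state pairs the tail index required of the next term with the current [G]. *)
pose next n (mG : nat * set S) := let s := f (n, mG.1, mG.2) in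
  (bnd s, mG.2 `&` \bigcap_(a in B n) [set w | mG.2 (mul (h a s) w)]).
pose st := nat_rect (fun=> nat * set S)%type (0, E) next.
have pst n : p (st n).2.
  elim: n => [//|n IH]; rewrite /= pU.1 IH /=.
  apply: ultra_finite_bigcap => [//|//|a Ba].
  by have [_ /(_ _ Ba)[]] := fP (n, (st n).1, (st n).2) IH.
exists (fun n => f (n, (st n).1, (st n).2)), (fun n => (st n).2); split=> //.
- by have [] := fP (0, 0, E) pE.
- by move=> n; have [] := fP (n.+1, (st n.+1).1, (st n.+1).2) (pst n.+1).
- by move=> n w [].
- move=> n a Ba; have [_ /(_ _ Ba)[Gt _]] := fP (n, (st n).1, (st n).2) (pst n).
  by split=> // w [_]; apply.
Qed.

End Galvin.

(** * Located words *)

Section LocatedWords.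
Context {T : choiceType}.
Implicit Types (x a : T) (B : nat -> set T) (v : nat -> seq T).
Implicit Types (w la : seq (nat * T)).

(* The index lists [la] of [const_span], with indices at least [n]. *)
Definition located B n : set (seq (nat * T)) :=
  [set la | [/\ la <> [::], sorted ltn (unzip1 la)
              & forall l a, (l, a) \in la -> n <= l /\ B l a]].

Definition var_located B x n : set (seq (nat * T)) :=
  located (fun l => B l `|` [set x]) n `&` [set la | exists l, (l, x) \in la].

Definition letter_subst x a (c : T) : T := if c == x then a else c.

Definition lsubst x a la : seq (nat * T) :=
  [seq (z.1, letter_subst x a z.2) | z <- la].

(** The successor makes words located from [sup_index la] on start strictly after [la]. *)
Definition sup_index la : nat := \max_(z <- la) z.1.+1.

Lemma sup_indexP la l a : (l, a) \in la -> l < sup_index la.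
Proof.
move=> la_in.
exact: (@leq_bigmax_seq _ la xpredT (fun z => z.1.+1) _ la_in isT).
Qed.

Lemma located_le B m n : m <= n -> located B n `<=` located B m.
Proof.
move=> mn la [la0 las laB]; split=> // l a /laB[nl Bla].
by split=> //; exact: leq_trans nl.
Qed.

Lemma var_located_le B x m n : m <= n -> var_located B x n `<=` var_located B x m.
Proof. by move=> mn la [/(located_le _ _ _ mn)]. Qed.

Lemma located_cat B n w w' : located B n w ->
  located B (maxn n (sup_index w)) w' -> located B n (w ++ w').
Proof.
move=> [w0 ws wB] [w'0 w's w'B]; split.
- by case: w w0 {ws wB w'B}.
- rewrite /unzip1 map_cat sorted_pairwise; last exact: ltn_trans.
  rewrite pairwise_cat -!sorted_pairwise; try exact: ltn_trans.
  rewrite ws w's !andbT; apply/allrelP => i j.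
  move=> /mapP[[i' a] wi ->] /mapP[[j' b] w'j ->].
  have [+ _] := w'B _ _ w'j; rewrite geq_max => /andP[_]; apply: leq_trans.
  exact: sup_indexP wi.
- move=> l a; rewrite mem_cat => /orP[/wB//|/w'B[+ Bl]].
  by rewrite geq_max => /andP[].
Qed.

Lemma located_var B x n w :
  located B n w -> located (fun l => B l `|` [set x]) n w.
Proof. by move=> [w0 ws wB]; split=> // l a /wB[? ?]; split=> //; left. Qed.

Lemma lsubst_id B x a n w :
  (forall l, ~ B l x) -> located B n w -> lsubst x a w = w.
Proof.
move=> Bx [_ _ wB]; rewrite /lsubst -[RHS]map_id; apply/eq_in_map => -[l c] lc /=.
rewrite /letter_subst; case: eqP => // cx.
by have [_] := wB _ _ lc; rewrite cx => /Bx.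
Qed.

Lemma located_lsubst B x a n w : (forall l, n <= l -> B l a) ->
  var_located B x n w -> located B n (lsubst x a w).
Proof.
move=> Ba [[w0 ws wB] _]; split; first by case: w w0 {ws wB}.
  by rewrite /unzip1 -map_comp.
move=> l c /mapP[[l' c'] lc [-> ->]].
have [nl Bc] := wB _ _ lc; split=> //.
rewrite /letter_subst; case: eqP => [_|c'x]; first exact: Ba.
by case: Bc.
Qed.

(** The substitutions by letters of all the [B n] are treated at once, so that a single pair [p],
    [q] serves every [n]. *)
Lemma exists_located_ultrafilters (B : nat -> set T) x :
    (forall n, B n !=set0) -> (forall n, B n `<=` B n.+1) ->
    (forall n, ~ B n x) ->
  exists p q, [/\ ultra_on (located B) p, @conv _ cat p p = p,
    ultra_on (var_located B x) q & forall n a, B n a -> push (lsubst x a) q = p].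
Proof.
move=> Bn0 Bincr Bx.
have Ble m n : m <= n -> B m `<=` B n.
  move=> /subnKC <-; elim: (n - m) => [|d IH]; first by rewrite addn0.
  by rewrite addnS => a /IH; exact: Bincr.
have [|n||||||||p [q [pW pp qV hq]]] := @exists_ultra_retract _ cat (@catA _)
  (located B) (var_located B x) [set lsubst x a | a in \bigcup_n B n].
- by move=> m n; exact: located_le.
- have [a Ba] := Bn0 n; exists [:: (n, a)]; split=> // l b.
  by rewrite inE => /eqP[-> ->].
- by move=> m n; exact: var_located_le.
- move=> n; exists [:: (n, x)]; split; last by exists n; rewrite inE.
  by split=> // l b; rewrite inE => /eqP[-> ->]; split=> //; right.
- by move=> n w Ww; exists (maxn n (sup_index w)) => w'; exact: located_cat.
- move=> n w Ww; exists (maxn n (sup_index w)) => w' [w'V [l lx]].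
  split; first by apply: located_cat => //; exact: located_var.
  by exists l; rewrite mem_cat lx orbT.
- move=> n w [Vw [l lx]]; exists (maxn n (sup_index w)) => w' Ww'.
  split; first by apply: located_cat => //; exact: located_var.
  by exists l; rewrite mem_cat lx.
- move=> n w [Vw [l lx]]; exists (maxn n (sup_index w)) => w' [w'V _].
  split; first exact: located_cat.
  by exists l; rewrite mem_cat lx.
- move=> _ [a [m _ Ba] <-]; split.
  + by move=> w w'; rewrite /lsubst map_cat.
  + by move=> w; exact: lsubst_id.
  (* The letter [a] comes from [B m], so it is known to be admissible only at indices from [m]
     on. *)
  + move=> n; exists (maxn m n) => w /(located_lsubst _ _ a).
    move=> /(_ (fun l ml => Ble _ _ (leq_trans (leq_maxl m n) ml) _ Ba)).
    by apply: located_le; rewrite leq_maxr.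
exists p, q; split=> // n a Ba; apply: hq; exists a => //.
by exists n.
Qed.

Definition word x v la : seq T := flatten [seq subst x (v z.1) z.2 | z <- la].

(** A block keeps occurrences of [x] only when its own letter is [x], and these are the letters that
    [lsubst] replaces. *)
Lemma word_lsubst x v a w : subst x (word x v w) a = word x v (lsubst x a w).
Proof.
rewrite /word /subst map_flatten -!map_comp; congr flatten.
apply: eq_map => -[l c] /=; rewrite -map_comp; apply: eq_map => b /=.
by rewrite /letter_subst; case: (b =P x) => // /eqP/negbTE->.
Qed.

Lemma word_flatten x v (s : seq (seq (nat * T))) :
  word x v (flatten s) = flatten [seq word x v w | w <- s].
Proof. by elim: s => //= w s IH; rewrite -IH /word map_cat flatten_cat. Qed.

(** Induction on [la] from its first index [l]: the tail is located from [l.+1] on, so it lies in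
    [G l.+1] and may follow the image of [t l]. Monotonicity of [G] bridges the skipped indices. *)
Lemma flatten_span_sequence x B (t : nat -> seq (nat * T))
    (G : nat -> set (seq (nat * T))) :
    (forall n, G n.+1 `<=` G n) ->
    (forall n a, B n a -> G n (lsubst x a (t n)) /\
       forall w, G n.+1 w -> G n (lsubst x a (t n) ++ w)) ->
  forall n la, located B n la ->
    G n (flatten [seq lsubst x z.2 (t z.1) | z <- la]).
Proof.
move=> Gdecr Gt n la.
have Gle i j : i <= j -> G j `<=` G i.
  move=> /subnKC <-; elim: (j - i) => [|d IH]; first by rewrite addn0.
  by rewrite addnS => w /Gdecr /IH.
elim: la n => [n []//|[l a] la IH] n [_ las laB].
have [nl Bla] := laB l a (mem_head _ _).
have [Ga Gaw] := Gt _ _ Bla.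
apply: (Gle _ _ nl) => /=.
have [->|la0] := eqVneq la [::]; first by rewrite cats0.
apply: Gaw; apply: IH; split; first exact/eqP.
  exact: path_sorted las.
move=> l' b lb.
have [_ Bb] : n <= l' /\ B l' b by apply: laB; rewrite inE lb orbT.
split=> //; move: las => /=; rewrite (path_sortedE ltn_trans) => /andP[/allP + _].
by apply; apply/mapP; exists (l', b).
Qed.

End LocatedWords.

(** * From located words back to words *)

Theorem theorem39 (T : choiceType) (A : nat -> set T) (x : T)
  (A_fin : forall n, finite_set (A n))
  (A_neq0 : forall n, A n !=set0)
  (A_incr : forall n, A n `<=` A n.+1)
  (x_notin : ~ alphabet A x)
  (k : nat) (v : nat -> seq T)
  (v_var : forall n, variable_words A x (v n))
  (r : nat) (r_ge2 : 2 <= r) (E : 'I_r -> set (seq T))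
  (E_cover : inf_const_span x v (fun n => A (k + n)) = \bigcup_i E i) :
  exists (i : 'I_r) (u : nat -> seq T),
    block_subseq A x k v u /\
    inf_const_span x u (fun n => A (k + n)) `<=` E i.
Proof.
pose B n := A (k + n).
have [|n|n Bx|p [q [pW pp qV hq]]] := exists_located_ultrafilters B x.
- by move=> n; exact: A_neq0.
- by rewrite /B addnS; exact: A_incr.
- by apply: x_notin; exists (k + n).
have pU := pW.1.
(* The colouring is pulled back along [word]; the pulled-back classes cover [located B 0], which
   belongs to [p]. *)
have [i pE] : exists i, p [set w | E i (word x v w)].
  apply: ultra_ord_bigcup => //; apply: (ultraS _ _ _ pU _ (pW.2 0)).
  move=> w [w0 ws wB].
  have : inf_const_span x v B (word x v w).
    exists (sup_index w) => //; exists w; split=> // l a lw.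
    have [_ Bla] := wB _ _ lw; split=> //=.
    exact/ltnW/(sup_indexP _ _ _ lw).
  by rewrite E_cover => -[i _ Ei]; exists i.
have [t [G [G0 V0 VS Gdecr Gt]]] := exists_span_sequence (lsubst x) B p q _
  sup_index _ (fun n => A_fin (k + n)) pU pp qV hq pE.
exists i, (fun n => word x v (t n)); split; last first.
  move=> _ [m _ [la [la0 las laB ->]]].
  (* [word] respects concatenation and substitution, so a span word of [u] is read off from this
     located word, and [G 0] is the pulled-back colour class. *)
  have : G 0 (flatten [seq lsubst x z.2 (t z.1) | z <- la]).
    apply: (flatten_span_sequence _ _ _ _ Gdecr Gt); split=> // l a /laB[].
    by move=> /andP[].
  rewrite G0 /= word_flatten -map_comp.
  by under eq_map do rewrite /= -word_lsubst.
(* Each block ends just after the last index used by [t n]; indices skipped between two terms fall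
   into the later block. *)
pose m n := if n is n'.+1 then sup_index (t n') else 0.
have Vt n : var_located B x (m n) (t n) by case: n.
move=> l; exists m; split=> // n _; have [[t0 ts tB] [lx tlx]] := Vt n.
  have [ml _] := tB _ _ tlx; apply: leq_ltn_trans ml _.
  exact: (sup_indexP _ _ _ tlx).
split; last first.
  exists (t n); split=> // l' a lt; have [ml Ba] := tB _ _ lt.
  (* The upper end of a span is inclusive, hence the predecessor; it is harmless because the index
     [l'] makes [sup_index (t n)] positive. *)
  split=> //; rewrite ml /= -ltnS prednK; first exact: (sup_indexP _ _ _ lt).
  exact: leq_ltn_trans (leq0n _) (sup_indexP _ _ _ lt).
split.
  (* The letter [x] at index [lx] leaves [v lx] unchanged, and [v lx] contains [x]. *)
  apply/flattenP; exists (subst x (v lx) x); first by apply/mapP; exists (lx, x).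
  apply/mapP; exists x; first exact: (v_var lx).1.
  by rewrite eqxx.
move=> c /flattenP[_ /mapP[[l' a] lt ->] /mapP[d dv ->]] /=.
case: eqP => [_|_]; last exact: (v_var l').2.
have [_ [Ba|->]] := tB _ _ lt; last by right.
by left; exists (k + l').
Qed.
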